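(* Let $\mathcal S$ be an irreducible c.s.r. semigroup of real $3\times3$ matrices whose minimal rank of elements is $r=2$. Then, up to a linear similarity (replacing all $A\in\mathcal S$ by $T^{-1}AT$ with one invertible real matrix $T$), there are two equal concentric two-dimensional Euclidean discs in $\mathbb R^3$, centered at the origin and lying in mutually orthogonal planes, such that every operator from $\mathcal S$ maps each of these two discs onto itself or onto the other disc.
   Context: Matrix semigroups are multiplicative and, as assumed in the paper, topologically closed. A matrix semigroup is c.s.r. (has constant spectral radius) if the spectral radius (maximal modulus of eigenvalues) of all its elements is the same and nonzero. A family of $d\times d$ matrices is irreducible if there is no proper linear subspace of $\mathbb R^d$ (different from $\{0\}$ and $\mathbb R^d$) invariant for all its matrices. *)

(* Defs.v *)
From HB Require Import structures.
From mathcomp Require Export all_boot all_order all_algebra.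
From mathcomp Require Export complex.
From mathcomp Require Export all_classical all_reals all_analysis.
Set Implicit Arguments.
Unset Strict Implicit.
Unset Printing Implicit Defensive.
Export Order.TTheory GRing.Theory Num.Theory.
Export numFieldNormedType.Exports.
Local Open Scope classical_set_scope.
Local Open Scope ring_scope.

(* Matrices act on column vectors. [eigenvalue] is the library's notion for the
   action on row vectors; a matrix has the same eigenvalues for both actions.
   For d > 0 the set below is finite and nonempty, so [sup] is a maximum. *)
Definition spectral_radius (R : realType) (d : nat) (A : 'M[R]_d) : R :=
  sup [set ComplexField.Normc.normc z
      | z in [set z : R[i] | eigenvalue (map_mx (real_complex R) A) z]].

Definition matrix_semigroup (R : realType) (d : nat) (S : set 'M[R]_d) : Prop :=
  (forall A B, S A -> S B -> S (A *m B)) /\ closed S.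

Definition constant_spectral_radius (R : realType) (d : nat)
    (S : set 'M[R]_d) : Prop :=
  exists2 rho : R, rho != 0 & forall A, S A -> spectral_radius A = rho.

Definition irreducible_family (R : realType) (d : nat)
    (S : set 'M[R]_d) : Prop :=
  forall V : {vspace 'cV[R]_d},
    (forall A, S A -> forall x, x \in V -> A *m x \in V) ->
    V = 0%VS \/ V = fullv.

Definition minimal_rank (R : realType) (d : nat)
    (S : set 'M[R]_d) (r : nat) : Prop :=
  (exists2 A, S A & \rank A = r) /\ (forall A, S A -> (r <= \rank A)%N).

Definition dotcv (R : realType) (d : nat) (x y : 'cV[R]_d) : R :=
  \sum_(i < d) x i 0 * y i 0.

(* The library's norm on matrices is the max norm, hence this one. *)
Definition euclidean_norm (R : realType) (d : nat) (x : 'cV[R]_d) : R :=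
  Num.sqrt (dotcv x x).

Definition disc (R : realType) (d : nat)
    (P : {vspace 'cV[R]_d}) (rho : R) : set 'cV[R]_d :=
  [set x | x \in P /\ euclidean_norm x <= rho].

Definition normal_to (R : realType) (d : nat)
    (P : {vspace 'cV[R]_d}) (n : 'cV[R]_d) : Prop :=
  forall x, x \in P -> dotcv n x = 0.

(* Two planes of R^3 always share a line, so they are orthogonal when their
   normals are, not when all their vectors are. *)
Definition orthogonal_planes (R : realType)
    (P Q : {vspace 'cV[R]_3}) : Prop :=
  [/\ \dim P = 2%N, \dim Q = 2%N
    & forall m n, normal_to P m -> normal_to Q n -> dotcv m n = 0].

(* Main.v *)
Require Import Defs.
From mathcomp Require Import ring lra.
Set Implicit Arguments.
Unset Strict Implicit.
Unset Printing Implicit Defensive.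
Local Open Scope classical_set_scope.
Local Open Scope ring_scope.

(* The traces of elements of S are bounded, and by irreducibility the trace form
   is nondegenerate on the span of S, so S is bounded, hence compact. Fix A0 in
   S of rank 2. The operators A0 X, X in S, act on the plane im A0 as a compact
   semigroup of invertible maps, which has an invariant Euclidean norm. Composed
   with a projection along ker A0 it yields a seminorm on R^3 that every X in S
   preserves on the image of every B in S of rank 2. Take two such image planes,
   u on their common line and v, w in the planes orthogonal to u, with equal
   images under the seminorm. Rank-2 kernels are lines along which one plane
   projects isometrically onto the other, which only leaves the lines spanned by
   v - w and v + w; both occur, and then only the planes <u, v> and <u, w> are
   images of rank-2 elements. Hence S permutes these, preserving the discs, and
   (u, v, w) is the required basis. *)

(** * Traces and spectral radius *)

Import ComplexField.Normc.

Section SpectralRadius.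
Variables (R : realType) (d : nat).
Implicit Type A : 'M[R]_d.

Lemma eigenvalue_le_spectral_radius A (z : R[i]) :
  eigenvalue (map_mx (real_complex R) A) z -> normc z <= spectral_radius A.
Proof.
move=> Az; apply: sup_upper_bound; last by exists z.
split; first by exists (normc z), z.
have [rs prs] := closed_field_poly_normal (char_poly (map_mx (real_complex R) A)).
(* The supremum needs an upper bound: every eigenvalue is among the roots [rs], so the sum of all
   their moduli will do. *)
exists (\sum_(r <- rs) normc r) => _ [w /= Aw <-].
have wrs : w \in rs.
  move: Aw; rewrite eigenvalue_root_char prs (monicP (char_poly_monic _)) scale1r.
  by rewrite root_prod_XsubC.
rewrite (big_rem w) //= lerDl; apply: sumr_ge0 => -[a b] _ /=.
exact: sqrtr_ge0.
Qed.

End SpectralRadius.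

(** The trace is the sum of the [d] complex eigenvalues counted with multiplicity. *)
Lemma trace_le_spectral_radius (R : realType) (d : nat) (A : 'M[R]_d) :
  `|\tr A| <= d%:R * spectral_radius A.
Proof.
case: d A => [|d'] A.
  by rewrite /mxtrace big_ord0 normr0 mul0r.
set A' := map_mx (real_complex R) A.
have [rs prs] := closed_field_poly_normal (char_poly A').
move: prs; rewrite (monicP (char_poly_monic _)) scale1r => prs.
have szrs : size rs = d'.+1.
  by have := size_char_poly A'; rewrite prs size_prod_XsubC => -[].
have trA : \tr A' = \sum_(r <- rs) r.
  apply: oppr_inj; rewrite -char_poly_trace // prs -szrs coefPn_prod_XsubC //.
  by rewrite szrs.
have -> : `|\tr A| = normc (\tr A').
  by rewrite trace_map_mx /= expr0n /= addr0 sqrtr_sqr.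
have le_sum : normc (\tr A') <= \sum_(r <- rs) normc r.
  rewrite trA; elim/big_ind2: _ => [|x1 x2 y1 y2 h1 h2|//].
    by rewrite normc0.
  exact: le_trans (le_normcD _ _) (lerD h1 h2).
apply: le_trans le_sum _.
have -> : d'.+1%:R * spectral_radius A = \sum_(r <- rs) spectral_radius A.
  by rewrite big_const_seq count_predT szrs iter_addr_0 mulr_natl.
rewrite big_seq [X in _ <= X]big_seq; apply: ler_sum => r rrs.
apply: eigenvalue_le_spectral_radius.
by rewrite eigenvalue_root_char -/A' prs root_prod_XsubC.
Qed.

(** * Explicit sums and determinants in dimensions two and three *)

Lemma ord3P (j : 'I_3) : [\/ j = 0, j = 1 | j = 2].
Proof.
by case: j => -[|[|[|//]]] ?; [constructor 1|constructor 2|constructor 3];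
  exact: val_inj.
Qed.

Section SmallDeterminants.
Variable R : comNzRingType.

Lemma sum_ord2 (V : zmodType) (F : 'I_2 -> V) : \sum_i F i = F 0 + F 1.
Proof.
rewrite !big_ord_recl big_ord0 addr0; congr (_ + F _); exact: val_inj.
Qed.

Lemma sum_ord3 (V : zmodType) (F : 'I_3 -> V) : \sum_i F i = F 0 + F 1 + F 2.
Proof.
rewrite !big_ord_recl big_ord0 addr0 addrA.
by congr (_ + F _ + F _); exact: val_inj.
Qed.

Lemma det_mx22 (A : 'M[R]_2) : \det A = A 0 0 * A 1 1 - A 0 1 * A 1 0.
Proof.
rewrite (expand_det_row _ 0) sum_ord2 /cofactor !det_mx11 !mxE /= mulN1r.
rewrite expr0 mul1r.
have -> : lift 0 0 = 1 :> 'I_2 by exact: val_inj.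
have -> : lift 1 0 = 0 :> 'I_2 by exact: val_inj.
by rewrite mulrN.
Qed.

Lemma det_mx33 (A : 'M[R]_3) : \det A =
  A 0 0 * (A 1 1 * A 2 2 - A 1 2 * A 2 1)
  - A 0 1 * (A 1 0 * A 2 2 - A 1 2 * A 2 0)
  + A 0 2 * (A 1 0 * A 2 1 - A 1 1 * A 2 0).
Proof.
rewrite (expand_det_row _ 0) sum_ord3 /cofactor !det_mx22 !mxE /=.
have -> : lift 0 0 = 1 :> 'I_3 by exact: val_inj.
have -> : lift 0 1 = 2 :> 'I_3 by exact: val_inj.
have -> : lift 1 0 = 0 :> 'I_3 by exact: val_inj.
have -> : lift 1 1 = 2 :> 'I_3 by exact: val_inj.
have -> : lift 2 0 = 0 :> 'I_3 by exact: val_inj.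
have -> : lift 2 1 = 1 :> 'I_3 by exact: val_inj.
by rewrite /= expr0 expr1 mul1r mulN1r sqrrN expr1n mul1r mulrN.
Qed.

End SmallDeterminants.

(* Newton's identities: det (1 - A) = 1 - e1 + e2 - e3. *)
Lemma det_1B_traces (F : numFieldType) (A : 'M[F]_3) :
  \det (1%:M - A) = 1 - \tr A + ((\tr A) ^+ 2 - \tr (A *m A)) / 2
    - ((\tr A) ^+ 3 - 3 * \tr A * \tr (A *m A) + 2 * \tr (A *m A *m A)) / 6.
Proof.
rewrite det_mx33 /mxtrace !sum_ord3 !mxE !sum_ord3 !mxE !sum_ord3 /=.
by field.
Qed.

(** * Bounded irreducible semigroups *)

Lemma mulmx_cV_eq0 (F : fieldType) m n (A : 'M[F]_(m, n)) :
  (forall x : 'cV_n, A *m x = 0) -> A = 0.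
Proof.
move=> A0; apply/matrixP => i j.
by have /matrixP/(_ i 0) := A0 (delta_mx j 0); rewrite -colE !mxE.
Qed.

(** Lengths of free tuples are bounded by the dimension, and an element of [S] outside the span
    would lengthen a longest one. Applied to a semigroup, this gives a basis of its span made of its
    own elements. *)
Lemma maximal_free_tuple (K : fieldType) (vT : vectType K) (S : set vT) :
  exists n (s : n.-tuple vT),
    [/\ free s, forall i, S (tnth s i) & forall x, S x -> x \in << s >>%VS].
Proof.
pose P n := `[< exists s : n.-tuple vT, free s /\ forall i, S (tnth s i) >].
have exP : exists n, P n.
  exists 0%N; apply/asboolP; exists [tuple]; split; first exact: nil_free.
  by case.
have leP n : P n -> (n <= \dim {:vT})%N.
  move=> /asboolP[s [/eqP ds _]]; rewrite -(size_tuple s) -ds.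
  by apply: dimvS; exact: subvf.
case: (ex_maxnP exP leP) => n /asboolP[s [frs Ss]] maxn.
exists n, s; split=> // x Sx; apply: contraT => xs.
suff /maxn : P n.+1 by rewrite ltnn.
apply/asboolP; exists [tuple of x :: s]; split; first by rewrite free_cons xs.
move=> i; rewrite (tnth_nth 0) /=; case: i => -[|i] //= ltin.
by have := Ss (Ordinal (ltin : (i < n)%N)); rewrite (tnth_nth 0).
Qed.

Lemma span_tupleP (K : fieldType) (vT : vectType K) n (s : n.-tuple vT) x :
  reflect (exists c : 'I_n -> K, x = \sum_i c i *: tnth s i) (x \in << s >>%VS).
Proof.
apply: (iffP idP) => [/coord_span xE|[c ->]].
  by exists (fun i => coord s i x); rewrite {1}xE; apply: eq_bigr => i _; rewrite (tnth_nth 0).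
by apply: memv_suml => i _; apply: memvZ; apply/memv_span/mem_tnth.
Qed.

Lemma norm_entry_le_sum (R : realDomainType) m n (A : 'M[R]_(m, n)) i j :
  `|A i j| <= \sum_k \sum_l `|A k l|.
Proof.
have Aij : `|A i j| <= \sum_l `|A i l| by rewrite (bigD1 j) //= lerDl sumr_ge0.
apply: le_trans Aij _; rewrite [leRHS](bigD1 i) //= lerDl.
by apply: sumr_ge0 => k _; exact: sumr_ge0.
Qed.

Section BoundedSemigroup.
Variables (R : realType) (S : set 'M[R]_3).
Hypothesis mulS : forall A B, S A -> S B -> S (A *m B).
Hypothesis irrS : irreducible_family S.

Section TraceForm.
Variables (n : nat) (s : n.-tuple 'M[R]_3).
Hypothesis Ss : forall i, S (tnth s i).
Hypothesis sS : forall A, S A -> A \in << s >>%VS.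

Lemma span_semigroupM (A B : 'M[R]_3) :
  A \in << s >>%VS -> B \in << s >>%VS -> A *m B \in << s >>%VS.
Proof.
move=> /span_tupleP[a ->] /span_tupleP[b ->]; rewrite mulmx_suml.
apply: memv_suml => i _; rewrite mulmx_sumr; apply: memv_suml => j _.
by rewrite -scalemxAl -scalemxAr; do 2 apply: memvZ; exact/sS/mulS.
Qed.

(* The radical of the trace form is an ideal of elements having no nonzero
   eigenvalue; irreducibility would give such an eigenvalue. *)
Lemma trace_form_nondegenerate (A : 'M[R]_3) : A \in << s >>%VS ->
  (forall B, B \in << s >>%VS -> \tr (A *m B) = 0) -> A = 0.
Proof.
move=> As trA; apply: contrapT => A0.
have [x Ax0] : exists x : 'cV[R]_3, A *m x <> 0.
  apply: contrapT => h; apply/A0/mulmx_cV_eq0 => x.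
  by apply: contrapT => Ax; apply: h; exists x.
(* [V] is the image of [A *m x] under the whole span, hence an [S]-invariant subspace. *)
pose w k := tnth s k *m (A *m x).
pose V := << [tuple w k | k < n] >>%VS.
have VS B : B \in << s >>%VS -> B *m (A *m x) \in V.
  move=> /span_tupleP[c ->]; rewrite mulmx_suml.
  apply/span_tupleP; exists c; apply: eq_bigr => k _.
  by rewrite tnth_mktuple scalemxAl.
have VE y : y \in V -> exists2 B, B \in << s >>%VS & y = B *m (A *m x).
  move=> /span_tupleP[c ->]; exists (\sum_k c k *: tnth s k).
    by apply/span_tupleP; exists c.
  rewrite mulmx_suml; apply: eq_bigr => k _.
  by rewrite tnth_mktuple scalemxAl.
have Vinv B : S B -> forall y, y \in V -> B *m y \in V.
  move=> SB y /VE[C Cs ->]; rewrite mulmxA; apply: VS.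
  by apply: span_semigroupM => //; exact: sS.
have [V0|VT] := irrS Vinv; last first.
  have /VE[B Bs xE] : x \in V by rewrite VT memvf.
  pose Y := B *m A.
  have trY C : C \in << s >>%VS -> \tr (Y *m C) = 0.
    move=> Cs; rewrite -mulmxA mxtrace_mulC -mulmxA; apply: trA.
    exact: span_semigroupM.
  have Ys : Y \in << s >>%VS by exact: span_semigroupM.
  (* [x = Y *m x] makes 1 an eigenvalue of [Y], whereas the traces of [Y], its square and its cube
     all vanish. *)
  have /eqP : \det (1%:M - Y) = 1.
    rewrite det_1B_traces -(mulmxA Y) !trY //; last exact: span_semigroupM.
    have -> : \tr Y = 0 by rewrite mxtrace_mulC; exact: trA.
    by rewrite !expr0n /= !(mulr0, mul0r, subr0, addr0).
  rewrite -subr_eq0 => /eqP dY.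
  have uY : 1%:M - Y \in unitmx by rewrite unitmxE (subr0_eq dY) unitr1.
  apply: Ax0; rewrite -[x](mulKmx uY) mulmxBl mul1mx -mulmxA -xE subrr.
  by rewrite !mulmx0.
(* In the remaining case [S] kills [A *m x], whose line is then invariant, of dimension neither 0
   nor 3. *)
have SAx B : S B -> B *m (A *m x) = 0.
  by move=> SB; apply/eqP; rewrite -memv0 -V0; exact/VS/sS.
have linv B : S B -> forall y, y \in <[A *m x]>%VS -> B *m y \in <[A *m x]>%VS.
  by move=> SB y /vlineP[k ->]; rewrite -scalemxAr SAx // scaler0 mem0v.
have [l0|/(congr1 (fun U => \dim U))] := irrS linv.
  by apply: Ax0; apply/eqP; rewrite -memv0 -l0 memv_line.
by rewrite dim_vline dimvf; case: eqP.
Qed.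

End TraceForm.

(** The coordinates of [A] in a basis taken from [S] are obtained by applying the inverse Gram
    matrix of the trace form to the traces of the products of [A] with the basis. These products lie
    in [S], so their traces are bounded by [c]. *)
Lemma irreducible_semigroup_bounded c : (forall A, S A -> `|\tr A| <= c) ->
  exists M, forall A, S A -> forall i j, `|A i j| <= M.
Proof.
move=> trc; have [n [s [frs Ss sS]]] := maximal_free_tuple S.
pose G : 'M[R]_n := \matrix_(k, l) \tr (tnth s k *m tnth s l).
have Gunit : G \in unitmx.
  (* A null vector of [G] gives the coordinates of an element of the radical of the trace form. *)
  rewrite unitmxE unitfE; apply/negP => /det0P[v v0 vG].
  pose A := \sum_k v 0 k *: tnth s k.
  have A0 : A = 0.
    apply: (trace_form_nondegenerate Ss sS).
      by apply/span_tupleP; exists (v 0).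
    move=> B /span_tupleP[b ->]; rewrite mulmx_sumr linear_sum big1 // => l _.
    rewrite -scalemxAr linearZ /= mulmx_suml linear_sum /=.
    have /rowP/(_ l) := vG; rewrite !mxE => vGl.
    rewrite (eq_bigr (fun k => v 0 k * G k l)) ?vGl ?mulr0 // => k _.
    by rewrite -scalemxAl linearZ /= mxE.
  move/negP: v0; apply; apply/eqP/rowP => k; rewrite mxE.
  rewrite -(coord_sum_free (v 0) k frs).
  suff -> : \sum_(i < n) v 0 i *: s`_i = A by rewrite A0 linear0.
  by apply: eq_bigr => i _; rewrite (tnth_nth 0).
pose B k := \sum_l c * `|invmx G l k|.
pose M : 'M[R]_3 := \matrix_(i, j) \sum_k B k * `|tnth s k i j|.
exists (\sum_i \sum_j `|M i j|).
move=> A SA i j; have /span_tupleP[a AE] := sS A SA.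
have aE : \row_k a k = (\row_l \tr (A *m tnth s l)) *m invmx G.
  apply: (canRL (mulmxK Gunit)); apply/rowP => l; rewrite !mxE AE mulmx_suml.
  rewrite linear_sum; apply: eq_bigr => k _ /=.
  by rewrite !mxE -scalemxAl linearZ.
have aB k : `|a k| <= B k.
  have /rowP/(_ k) := aE; rewrite !mxE => ->.
  apply: le_trans (ler_norm_sum _ _ _) _; apply: ler_sum => l _.
  by rewrite mxE normrM ler_wpM2r // trc //; exact: mulS.
have AM : `|A i j| <= M i j.
  rewrite mxE {1}AE summxE; apply: le_trans (ler_norm_sum _ _ _) _.
  by apply: ler_sum => k _; rewrite mxE normrM ler_wpM2r.
by apply: le_trans AM (le_trans (ler_norm _) (norm_entry_le_sum _ _ _)).
Qed.

End BoundedSemigroup.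

(** * Invariant quadratic forms in dimension two *)

(** [vec_mx] only rearranges entries, so it carries the Heine-Borel theorem from row vectors to
    matrices. *)
Lemma bounded_closed_compact_mx (R : realType) m n (S : set 'M[R]_(m, n)) c :
  closed S -> (forall A, S A -> forall i j, `|A i j| <= c) -> compact S.
Proof.
move=> clS bS.
have cont_vec : continuous (vec_mx : 'rV[R]_(m * n) -> 'M[R]_(m, n)).
  move=> u A /nbhs_ballP[e /= e0 eA]; apply/nbhs_ballP; exists e => //= v [_ uv].
  by apply: eA; split => // i j; rewrite !mxE.
have -> : S = vec_mx @` (vec_mx @^-1` S).
  apply/seteqP; split => [A SA|_ [v Sv <-]//].
  by exists (mxvec A); rewrite /= mxvecK.
apply: continuous_compact; first exact: continuous_subspaceT.
apply: bounded_closed_compact; last by apply: preimage_closed => // x _; exact: cont_vec.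
exists `|c|; split; first exact: num_real.
move=> M cM v /= Sv; apply/ltW; apply: le_lt_trans cM.
rewrite (_ : `|v| = mx_norm v) // mx_normrE; apply/bigmax_leP; split=> // -[i k] _ /=.
rewrite (ord1 i); have [j l] := mxvec_indexP k.
by have := bS _ Sv j l; rewrite mxE => /le_trans; apply; exact: ler_norm.
Qed.

Section InvariantForm.
Variable R : realType.
Implicit Types (t : 'rV[R]_3) (g : 'M[R]_2) (x y : R).

(** A row [t] with entries a, b, d stands for the symmetric matrix with rows (a, b) and (b, d);
    [qdet] is the determinant of that matrix. *)
Definition qform t x y := t 0 0 * x ^+ 2 + 2 * t 0 1 * (x * y) + t 0 2 * y ^+ 2.

Definition qdet t := t 0 0 * t 0 2 - t 0 1 ^+ 2.

Lemma qform_continuous x y : continuous (fun t => qform t x y).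
Proof.
move=> t.
have h j : (u : 'rV[R]_3) 0 j @[u --> t] --> t 0 j := @coord_continuous _ 1 3 0 j t.
have k (a : R) : a @[_ --> t] --> a by exact: cst_continuous.
exact: cvgD (cvgD (cvgM (h 0) (k _)) (cvgM (cvgM (k 2) (h 1)) (k _)))
  (cvgM (h 2) (k _)).
Qed.

Lemma qdet_continuous : continuous qdet.
Proof.
move=> t.
have h j : (u : 'rV[R]_3) 0 j @[u --> t] --> t 0 j := @coord_continuous _ 1 3 0 j t.
exact: cvgB (cvgM (h 0) (h 2)) (cvgM (h 1) (h 1)).
Qed.

Definition row3 (a b c : R) : 'rV[R]_3 := \row_j [:: a; b; c]`_j.

(** If Q is the symmetric matrix of [t], these are the entries of g^T Q g. *)
Definition qcomp t g := row3 (qform t (g 0 0) (g 1 0))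
  (t 0 0 * g 0 0 * g 0 1 + t 0 1 * (g 0 0 * g 1 1 + g 0 1 * g 1 0)
    + t 0 2 * g 1 0 * g 1 1) (qform t (g 0 1) (g 1 1)).

Lemma qform_comp t g x y : qform (qcomp t g) x y =
  qform t (g 0 0 * x + g 0 1 * y) (g 1 0 * x + g 1 1 * y).
Proof. by rewrite /qform !mxE /= /qform; ring. Qed.

Lemma qdet_comp t g : qdet (qcomp t g) = qdet t * (\det g) ^+ 2.
Proof. by rewrite /qdet !mxE /= /qform det_mx22; ring. Qed.

Section MaximalForm.
Variables (H : set 'M[R]_2) (c : R).
Hypothesis bH : forall g, H g -> forall i j, `|g i j| <= c.
Hypothesis mulH : forall g h, H g -> H h -> H (g *m h).
Hypothesis detH : forall g, H g -> (\det g) ^+ 2 = 1.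

(* Loewner: a form of maximal determinant in this set is unique, and the set is
   stable under composition with H, so that form is H-invariant. *)
Definition dominated_forms : set 'rV[R]_3 := [set t | forall x y,
  [/\ 0 <= qform t x y, qform t x y <= x ^+ 2 + y ^+ 2 &
      forall g, H g -> qform (qcomp t g) x y <= x ^+ 2 + y ^+ 2]].

(** For fixed [x] and [y] each condition is a closed linear inequality in [t]; boundedness follows
    from the values at four vectors. *)
Lemma dominated_forms_compact : compact dominated_forms.
Proof.
apply: (@bounded_closed_compact_mx _ _ _ _ 1).
  (* [Z] pairs points with upper bounds for the form there; the condition on [qcomp t g] becomes a
     bound at the image point under [g]. *)
  pose Z := [set z : R * R * R | z.1.1 ^+ 2 + z.1.2 ^+ 2 <= z.2 \/
    exists g x y, [/\ H g, z.1.1 = g 0 0 * x + g 0 1 * y,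
      z.1.2 = g 1 0 * x + g 1 1 * y & z.2 = x ^+ 2 + y ^+ 2]].
  have -> : dominated_forms =
     (\bigcap_(p in [set: R * R]) [set t | 0 <= qform t p.1 p.2]) `&`
     (\bigcap_(z in Z) [set t | qform t z.1.1 z.1.2 <= z.2]).
    apply/seteqP; split=> [t Qt|t [Q0 QZ] x y].
      split=> [[x y] _|[[x y] r] /=].
        by have [] := Qt x y.
      move=> [/= h|[g [x' [y' [Hg /= -> -> ->]]]]].
        by apply: le_trans h; have [] := Qt x y.
      by rewrite -qform_comp; have [_ _ ->] := Qt x' y'.
    split; first exact: (Q0 (x, y)).
      by apply: (QZ (x, y, x ^+ 2 + y ^+ 2)); left => /=.
    move=> g Hg; rewrite qform_comp.
    apply: (QZ (_, _, x ^+ 2 + y ^+ 2)); right.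
    by exists g, x, y.
  apply: closedI; apply: closed_bigI => p _.
    apply: (@preimage_closed _ _ (fun t => qform t p.1 p.2) [set r | 0 <= r]).
      by move=> t _; exact: qform_continuous.
    exact: closed_ge.
  apply: (@preimage_closed _ _ (fun t => qform t p.1.1 p.1.2) [set r | r <= p.2]).
    by move=> t _; exact: qform_continuous.
  exact: closed_le.
move=> t Qt i j; rewrite (ord1 i).
(* The basis vectors bound the diagonal coefficients, and the vectors (1, 1) and (1, -1) bound the
   mixed one. *)
have [p1 p2 _] := Qt 1 0; have [q1 q2 _] := Qt 0 1.
have [r1 r2 _] := Qt 1 1; have [s1 s2 _] := Qt 1 (-1).
move: p1 p2 q1 q2 r1 r2 s1 s2; rewrite /qform ler_norml.
have [->|->|->] := ord3P j.
all: by move=> *; apply/andP; split; lra.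
Qed.

(** Entries bounded by [c] stretch the squared norm by at most 4 c^2, so the Euclidean form divided
    by 1 + 4 c^2 is dominated. Its determinant is positive, hence so is the maximal one. *)
Lemma dominated_forms_mem_eps :
  exists2 e, 0 < e & dominated_forms (row3 e 0 e).
Proof.
have c1 : 0 < 1 + 4 * c ^+ 2 by rewrite ltr_pwDl // mulr_ge0 // sqr_ge0.
exists (1 + 4 * c ^+ 2)^-1; first by rewrite invr_gt0.
set e := _^-1 => x y; have e0 : 0 <= e by rewrite invr_ge0 ltW.
have qe u v : qform (row3 e 0 e) u v = e * (u ^+ 2 + v ^+ 2).
  by rewrite /qform !mxE /=; ring.
have e1 z w : 0 <= z -> w <= (1 + 4 * c ^+ 2) * z -> e * w <= z.
  by move=> z0 wz; rewrite ler_pdivrMl.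
split; first by rewrite qe mulr_ge0 // addr_ge0 // sqr_ge0.
  by rewrite qe; apply: e1; [nra|nra].
move=> g Hg; rewrite qform_comp qe; apply: e1; first nra.
have sq i j : g i j ^+ 2 <= c ^+ 2.
  by rewrite -real_normK ?num_real // lerXn2r // ?nnegrE ?bH // (le_trans _ (bH Hg i j)).
have row i : (g i 0 * x + g i 1 * y) ^+ 2 <= 2 * c ^+ 2 * (x ^+ 2 + y ^+ 2).
  have := sq i 0; have := sq i 1; move: (g i 0) (g i 1) => a b bc ac.
  have h : (a * x + b * y) ^+ 2 <= (a ^+ 2 + b ^+ 2) * (x ^+ 2 + y ^+ 2).
    have := sqr_ge0 (a * y - b * x); nra.
  apply: le_trans h _; apply: ler_wpM2r; first nra.
  lra.
have := row 0; have := row 1; have := sqr_ge0 x; have := sqr_ge0 y; lra.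
Qed.

(** The third condition on [t] gives the second one on [qcomp t g], and passes to it because [H] is
    closed under products. *)
Lemma dominated_forms_comp t g : H g ->
  dominated_forms t -> dominated_forms (qcomp t g).
Proof.
move=> Hg Qt x y; split.
- by rewrite qform_comp; have [] := Qt (g 0 0 * x + g 0 1 * y) (g 1 0 * x + g 1 1 * y).
- by have [_ _ ->] := Qt x y.
move=> h Hh; rewrite !qform_comp.
have [_ _ /(_ _ (mulH Hg Hh))] := Qt x y; apply: le_trans.
by rewrite qform_comp !mxE !sum_ord2 /qform le_eqVlt; apply/orP; left; apply/eqP; ring.
Qed.

(** The equality case of log-concavity. When both determinants equal D, the sum D (a - a')^2 + (a b'
    - a' b)^2 is a positive multiple of the excess of the midpoint determinant over D, so both
    squares vanish. *)
Lemma qdet_midpoint (a b d a' b' d' : R) : 0 < a -> 0 < a' ->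
  0 < a * d - b ^+ 2 -> a * d - b ^+ 2 = a' * d' - b' ^+ 2 ->
  (a + a') / 2 * ((d + d') / 2) - ((b + b') / 2) ^+ 2 <= a * d - b ^+ 2 ->
  [/\ a = a', b = b' & d = d'].
Proof.
move=> a0 a'0 dt du dw.
have key : (a * d - b ^+ 2) * (a - a') ^+ 2 + (a * b' - a' * b) ^+ 2 <= 0.
  have h : a * a' * (a * d' + a' * d - 2 * b * b' - 2 * (a * d - b ^+ 2)) <= 0.
    apply: mulr_ge0_le0; first by rewrite mulr_ge0 ?ltW.
    by move: dw; lra.
  have -> : (a * d - b ^+ 2) * (a - a') ^+ 2 + (a * b' - a' * b) ^+ 2 =
   a * a' * (a * d' + a' * d - 2 * b * b' - 2 * (a * d - b ^+ 2))
    + a ^+ 2 * ((a * d - b ^+ 2) - (a' * d' - b' ^+ 2)) by ring.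
  by rewrite du subrr mulr0 addr0 -du.
have aa : a = a'.
  apply/eqP; rewrite -subr_eq0 -sqrf_eq0; apply/eqP.
  have s1 := sqr_ge0 (a - a'); have s2 := sqr_ge0 (a * b' - a' * b).
  apply: le_anti; rewrite s1 andbT -(pmulr_rle0 _ dt); lra.
have bb : b = b'.
  apply/eqP; rewrite -subr_eq0 -sqrf_eq0; apply/eqP.
  have s2 := sqr_ge0 (b - b'); apply: le_anti; rewrite s2 andbT.
  rewrite -(pmulr_rle0 _ (exprn_gt0 2 a0)) -exprMn.
  by move: key; rewrite -aa subrr; lra.
have dd : d = d'.
  apply: (mulfI (lt0r_neq0 a0)); move: du; rewrite -aa -bb; lra.
by [].
Qed.

(* The determinant is strictly log-concave on positive definite forms. *)
Lemma exists_invariant_form : exists t,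
  [/\ 0 < t 0 0, 0 < qdet t & forall g, H g -> forall x y,
   qform t (g 0 0 * x + g 0 1 * y) (g 1 0 * x + g 1 1 * y) = qform t x y].
Proof.
have [e e0 Qe] := dominated_forms_mem_eps.
have [|t + maxt] := compact_EVT_max _ dominated_forms_compact
  (continuous_subspaceT qdet_continuous).
  by exists (row3 e 0 e).
rewrite inE => Qt; have {maxt} maxt u : dominated_forms u -> qdet u <= qdet t.
  by move=> Qu; apply: maxt; rewrite inE.
have dt : 0 < qdet t.
  by apply: lt_le_trans (maxt _ Qe); rewrite /qdet !mxE /=; nra.
have pos u : dominated_forms u -> 0 < qdet u -> 0 < u 0 0.
  move=> Qu; rewrite /qdet => du; have [+ _ _] := Qu 1 0.
  rewrite /qform; case: (ltgtP (u 0 0) 0) => [|//|]; first by lra.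
  by move=> u0; move: du; rewrite u0 mul0r; have := sqr_ge0 (u 0 1); lra.
exists t; split=> //; first exact: pos.
move=> g Hg x y; rewrite -qform_comp; suff -> : qcomp t g = t by [].
have := dominated_forms_comp Hg Qt; have := qdet_comp t g.
rewrite detH // mulr1; move: (qcomp t g) => u du Qu.
(* [u] has the same determinant as [t]. The midpoint [w] is dominated by convexity, so its
   determinant does not exceed the maximum, which forces [u = t]. *)
pose w := row3 ((t 0 0 + u 0 0) / 2) ((t 0 1 + u 0 1) / 2) ((t 0 2 + u 0 2) / 2).
have wE x' y' : qform w x' y' = (qform t x' y' + qform u x' y') / 2.
  by rewrite /qform !mxE /=; field.
have Qw : dominated_forms w.
  move=> x' y'; have [a1 a2 a3] := Qt x' y'; have [b1 b2 b3] := Qu x' y'.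
  split; rewrite ?wE; [lra|lra|move=> h Hh].
  rewrite qform_comp wE -!qform_comp; have := a3 h Hh; have := b3 h Hh; lra.
have a0 := pos _ Qt dt; have a'0 : 0 < u 0 0 by apply: pos; rewrite ?du.
have := maxt _ Qw; rewrite /qdet !mxE /= => dw.
have [aa bb dd] := qdet_midpoint a0 a'0 dt (esym du) dw.
apply/rowP => j; have [->|->|->] := ord3P j.
all: by symmetry.
Qed.

(** Cholesky factorization of the invariant form: [M] is upper triangular and M^T M is the matrix of
    the form. *)
Lemma exists_isometrizing_matrix : exists2 M : 'M[R]_2, M \in unitmx &
  forall g (z : 'cV_2), H g ->
    dotcv (M *m (g *m z)) (M *m (g *m z)) = dotcv (M *m z) (M *m z).
Proof.
have [t [a0 dt invt]] := exists_invariant_form.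
set a := t 0 0 in a0.
pose r := Num.sqrt a; pose e := Num.sqrt (qdet t / a).
have r0 : 0 < r by rewrite sqrtr_gt0.
have r2 : r ^+ 2 = a by rewrite sqr_sqrtr ?ltW.
have e2 : e ^+ 2 = qdet t / a by rewrite sqr_sqrtr // divr_ge0 // ltW.
have e0 : 0 < e by rewrite sqrtr_gt0 divr_gt0.
pose M : 'M[R]_2 :=
  \matrix_(i, j) nth 0 (nth [::] [:: [:: r; t 0 1 / r]; [:: 0; e]] i) j.
have ME z : dotcv (M *m z) (M *m z) = qform t (z 0 0) (z 1 0).
  rewrite /dotcv !sum_ord2 !mxE !sum_ord2 !mxE /= -!expr2.
  rewrite mul0r add0r [(e * _) ^+ 2]exprMn e2 -r2 /qform /qdet -/a -r2.
  by field; rewrite gt_eqF.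
exists M; first by rewrite unitmxE det_mx22 !mxE /= mulr0 subr0 unitfE mulf_neq0 ?gt_eqF.
by move=> g z Hg; rewrite !ME !mxE !sum_ord2 invt.
Qed.

End MaximalForm.
End InvariantForm.

(** * The invariant seminorm *)

Lemma mulmx3_entry_continuous (R : realType) m n k l
    (P : 'M[R]_(m, n)) (Q : 'M[R]_(k, l)) i j :
  continuous (fun X : 'M[R]_(n, k) => (P *m X *m Q) i j).
Proof.
have -> : (fun X => (P *m X *m Q) i j) =
    (fun X => \sum_b \sum_a P i a * X a b * Q b j).
  by apply/funext => X; rewrite mxE; apply: eq_bigr => b _; rewrite mxE mulr_suml.
apply: continuous_big => [|b _]; first exact: add_continuous.
apply: continuous_big => [|a _ X]; first exact: add_continuous.
have h : (Y : 'M[R]_(n, k)) a b @[Y --> X] --> X a b := @coord_continuous _ n k a b X.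
have c (r : R) : r @[_ --> X] --> r by exact: cst_continuous.
exact: cvgM (cvgM (c _) h) (c _).
Qed.

(** The row space of [W *m A] lies in that of [A]; equal ranks make the two equal. *)
Lemma mulmx_rank_factorl (F : fieldType) m n k (W : 'M[F]_(k, m))
    (A : 'M[F]_(m, n)) :
  \rank (W *m A) = \rank A -> exists Z, A = Z *m (W *m A).
Proof.
move=> rWA; apply/submxP.
by rewrite -(geq_leqif (mxrank_leqif_sup (submxMl W A))) rWA.
Qed.

Lemma mulmx_rank_factorr (F : fieldType) m n k (A : 'M[F]_(m, n))
    (W : 'M[F]_(n, k)) :
  \rank (A *m W) = \rank A -> exists Z, A = A *m W *m Z.
Proof.
rewrite -mxrank_tr trmx_mul -(mxrank_tr A) => /mulmx_rank_factorl[Z AE].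
by exists Z^T; apply: trmx_inj; rewrite !trmx_mul trmxK.
Qed.

Section InvariantSeminorm.
Variables (R : realType) (S : set 'M[R]_3) (c : R) (A0 : 'M[R]_3).
Hypothesis clS : closed S.
Hypothesis bS : forall A, S A -> forall i j, `|A i j| <= c.
Hypothesis mulS : forall A B, S A -> S B -> S (A *m B).
Hypothesis rankS : forall A, S A -> (2 <= \rank A)%N.
Hypothesis SA0 : S A0.

(** The squared determinant f is nonzero on [S], since A0 X A0 factors through p X i and has rank at
    least 2. Also f(X A0 Y) = f(X) f(Y). At a minimum L over the compact [S] this gives f(L) <=
    f(L)^2, so f(L) >= 1; likewise the maximum is at most 1. *)
Lemma det_compressed_sqr (p : 'M[R]_(2, 3)) (i : 'M[R]_(3, 2)) : i *m p = A0 ->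
  forall X, S X -> (\det (p *m X *m i)) ^+ 2 = 1.
Proof.
move=> ip; pose f X := (\det (p *m X *m i)) ^+ 2.
have f0 X : S X -> f X != 0.
  move=> SX; rewrite sqrf_eq0 -unitfE -[_ \is a _]/(_ \in unitmx) -row_free_unit.
  have : S (A0 *m X *m A0) by apply: mulS => //; exact: mulS.
  have -> : A0 *m X *m A0 = i *m (p *m X *m i) *m p by rewrite -ip !mulmxA.
  move=> /rankS le2; rewrite /row_free eqn_leq rank_leq_row /=.
  apply: leq_trans le2 _.
  exact: leq_trans (mxrankM_maxl _ _) (mxrankM_maxr _ _).
have fM X Y : S X -> S Y -> f (X *m A0 *m Y) = f X * f Y.
  by move=> SX SY; rewrite /f -exprMn -det_mulmx -ip !mulmxA.
have cf : continuous f.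
  move=> X; rewrite /f.
  have h a b := @mulmx3_entry_continuous _ _ _ _ _ p i a b X.
  have d : \det (p *m Y *m i) @[Y --> X] --> \det (p *m X *m i).
    rewrite det_mx22; under eq_fun do rewrite det_mx22.
    exact: cvgB (cvgM (h _ _) (h _ _)) (cvgM (h _ _) (h _ _)).
  exact: (cvgM d d).
have S0 : S !=set0 by exists A0.
have cS := bounded_closed_compact_mx clS bS.
have [U SU maxU] := compact_EVT_max S0 cS (continuous_subspaceT cf).
have [L SL minL] := compact_EVT_min S0 cS (continuous_subspaceT cf).
rewrite !inE in SL SU.
have fge0 X : 0 <= f X by exact: sqr_ge0.
have fgt0 X : S X -> 0 < f X by move=> SX; rewrite lt0r f0 //= fge0.
have L1 : 1 <= f L.
  have : f L <= f (L *m A0 *m L) by apply: minL; rewrite inE; do 2 apply: mulS => //.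
  by rewrite fM // ler_pMr // fgt0.
have U1 : f U <= 1.
  have : f (U *m A0 *m U) <= f U by apply: maxU; rewrite inE; do 2 apply: mulS => //.
  by rewrite fM // ger_pMr // fgt0.
move=> X SX; apply: le_anti; apply/andP; split.
  by apply: le_trans U1; apply: maxU; rewrite inE.
by apply: le_trans L1 _; apply: minL; rewrite inE.
Qed.

(** The seminorm is the Euclidean norm of [psi *m x]. For a rank factorization A0 = i p, the
    matrices p X i form a bounded semigroup with determinants 1 or -1, and [psi] is [p] followed by
    a matrix making them isometries. *)
Lemma invariant_seminorm : \rank A0 = 2%N ->
  exists (psi : 'M[R]_(2, 3)) W, A0 = W *m psi /\
    (forall B C (x : 'cV_3), S B -> \rank B = 2%N -> S C ->
      dotcv (psi *m (C *m (B *m x))) (psi *m (C *m (B *m x))) =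
      dotcv (psi *m (B *m x)) (psi *m (B *m x))).
Proof.
move=> rA0; have := mulmx_base A0.
move: (col_base A0) (row_base A0); rewrite rA0 => i p ip.
pose H := [set g | exists2 X, S X & g = p *m X *m i].
pose N : 'M[R]_2 := \matrix_(a, b) \sum_l (\sum_k `|p a k| * c) * `|i l b|.
have bH g : H g -> forall a b, `|g a b| <= \sum_a \sum_b `|N a b|.
  move=> [X SX ->] a b.
  apply: le_trans (le_trans (ler_norm _) (norm_entry_le_sum N a b)).
  rewrite !mxE; apply: le_trans (ler_norm_sum _ _ _) _.
  apply: ler_sum => l _; rewrite normrM ler_wpM2r // mxE.
  apply: le_trans (ler_norm_sum _ _ _) _; apply: ler_sum => k _.
  by rewrite normrM ler_wpM2l // bS.
have mulH g h : H g -> H h -> H (g *m h).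
  move=> [X SX ->] [Y SY ->]; exists (X *m A0 *m Y).
    by apply: mulS => //; exact: mulS.
  by rewrite -ip !mulmxA.
have detH g : H g -> (\det g) ^+ 2 = 1.
  by move=> [X SX ->]; exact: (det_compressed_sqr ip).
have [M Mu MH] := exists_isometrizing_matrix bH mulH detH.
exists (M *m p), (i *m invmx M); split; first by rewrite mulmxA (mulmxKV Mu).
move=> B C x SB rB SC.
(* [B *m A0] has the same image as [B], so [B *m x] can be written as [B *m i *m y]. *)
have [Z BE] : exists Z, B = B *m A0 *m Z.
  apply: mulmx_rank_factorr; apply/eqP; rewrite eqn_leq mxrankM_maxl /= rB.
  by apply: rankS; exact: mulS.
have -> : B *m x = B *m i *m (p *m Z *m x) by rewrite {1}BE -ip !mulmxA.
move: (p *m Z *m x) => y.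
have H_B : H (p *m B *m i) by exists B.
have H_CB : H (p *m (C *m B) *m i) by exists (C *m B) => //; exact: mulS.
have -> : M *m p *m (C *m (B *m i *m y)) = M *m (p *m (C *m B) *m i *m y).
  by rewrite !mulmxA.
have -> : M *m p *m (B *m i *m y) = M *m (p *m B *m i *m y) by rewrite !mulmxA.
by rewrite !MH.
Qed.

End InvariantSeminorm.

(** * Images and kernels of singular matrices *)

Lemma dotcv_eq0 (R : realType) d (x : 'cV[R]_d) : dotcv x x = 0 -> x = 0.
Proof.
move=> /eqP; rewrite psumr_eq0 => [/allP x0|i _]; last by rewrite -expr2 sqr_ge0.
apply/colP => i; rewrite mxE; apply/eqP.
by have := x0 i (mem_index_enum _); rewrite /= mulf_eq0 orbb.
Qed.

Lemma singular_kernel (F : fieldType) n (A : 'M[F]_n) :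
  A \notin unitmx -> exists2 x : 'cV_n, x != 0 & A *m x = 0.
Proof.
rewrite -unitmx_tr unitmxE unitfE negbK => /det0P[v v0 vA].
exists v^T; first by rewrite trmx_eq0.
by apply: trmx_inj; rewrite trmx_mul trmxK vA trmx0.
Qed.

Lemma kernel_line (F : fieldType) n (A : 'M[F]_n.+1) (x y : 'cV_n.+1) :
  \rank A = n -> x != 0 -> A *m x = 0 -> A *m y = 0 -> exists a, y = a *: x.
Proof.
move=> rA x0 Ax Ay.
have kerE (z : 'cV_n.+1) : A *m z = 0 -> (z^T <= kermx A^T)%MS.
  by move=> Az; apply/sub_kermxP; rewrite -trmx_mul Az trmx0.
have kx : (kermx A^T <= x^T)%MS.
  rewrite -(geq_leqif (mxrank_leqif_sup (kerE x Ax))) mxrank_ker mxrank_tr rA.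
  by rewrite subSnn rank_rV trmx_eq0 x0.
have /sub_rVP[a ya] := submx_trans (kerE y Ay) kx.
by exists a; apply: trmx_inj; rewrite ya linearZ.
Qed.

Lemma images_intersect (F : fieldType) n (A B : 'M[F]_n) :
  (n < \rank A + \rank B)%N ->
  exists a b : 'cV_n, A *m a = B *m b /\ A *m a != 0.
Proof.
move=> ltn.
have : (A^T :&: B^T)%MS != 0.
  rewrite -mxrank_eq0 -lt0n.
  have := mxrank_sum_cap A^T B^T; rewrite !mxrank_tr => E.
  case: posnP => // c0; move: ltn; rewrite -E c0 addn0 ltnNge.
  by rewrite rank_leq_row.
move=> /rowV0Pn[v]; rewrite sub_capmx => /andP[/submxP[a va] /submxP[b vb]] v0.
exists a^T, b^T; rewrite -[A]trmxK -[B]trmxK -!trmx_mul -va -vb.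
by rewrite trmx_eq0.
Qed.

Section Irreducible.
Variables (R : realType) (S : set 'M[R]_3).
Hypothesis irrS : irreducible_family S.
Variable B : 'M[R]_3.
Hypotheses (B0 : B != 0) (sB : B \notin unitmx).

(** The image is a nonzero proper subspace, as [B] is nonzero and singular. *)
Lemma image_not_invariant :
  exists2 C, S C & exists x : 'cV_3, forall y, C *m (B *m x) <> B *m y.
Proof.
apply: contrapT => h; pose V := limg (linfun (mulmx B : 'cV_3 -> 'cV_3)).
have VE x : x \in V -> exists y, x = B *m y.
  by move=> /memv_imgP[y _ ->]; exists y; rewrite lfunE.
have BV y : B *m y \in V.
  by apply/memv_imgP; exists y; rewrite ?memvf ?lfunE.
have VS C : S C -> forall x, x \in V -> C *m x \in V.
  move=> SC x /VE[y ->]; apply: contrapT => CBy; apply: h; exists C => //.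
  by exists y => z E; apply: CBy; rewrite E.
have [V0|VT] := irrS VS.
  move/eqP: B0; apply; apply: mulmx_cV_eq0 => x.
  by apply/eqP; rewrite -memv0 -V0.
have sBT : B^T \notin unitmx by rewrite unitmx_tr.
(* A vector killed by the transpose of [B] is orthogonal to the image of [B]; lying in that image,
   it would be orthogonal to itself. *)
have [v v0 vB] := singular_kernel sBT.
have /VE[y vy] : v \in V by rewrite VT memvf.
move/eqP: v0; apply; apply: dotcv_eq0.
have : (v^T *m v) 0 0 = 0.
  by rewrite {2}vy mulmxA -[B]trmxK -trmx_mul vB trmx0 mul0mx mxE.
by rewrite mxE => E; rewrite -[RHS]E; apply: eq_bigr => i _; rewrite mxE.
Qed.

Lemma kernel_not_invariant :
  exists2 C, S C & exists2 x : 'cV_3, B *m x = 0 & B *m (C *m x) <> 0.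
Proof.
apply: contrapT => h; pose V := lker (linfun (mulmx B : 'cV_3 -> 'cV_3)).
have VE x : x \in V <-> B *m x = 0.
  by rewrite memv_ker lfunE; split=> [/eqP|/eqP].
have VS C : S C -> forall x, x \in V -> C *m x \in V.
  move=> SC x /VE Bx; apply/VE; apply: contrapT => BCx; apply: h.
  by exists C => //; exists x.
have [V0|VT] := irrS VS.
  have [v v0 vB] := singular_kernel sB.
  by move/negP: v0; apply; rewrite -memv0 -V0; apply/VE.
move/eqP: B0; apply; apply: mulmx_cV_eq0 => x.
by apply/VE; rewrite VT memvf.
Qed.

End Irreducible.

Lemma orthonormal_frame2 (R : realType) (f : 'cV[R]_2) : dotcv f f = 1 ->
  exists g : 'cV[R]_2,
    (forall s t, dotcv (s *: f + t *: g) (s *: f + t *: g) = s ^+ 2 + t ^+ 2)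
    /\ forall y, exists s t, y = s *: f + t *: g.
Proof.
rewrite /dotcv sum_ord2; set a := f 0 0; set b := f 1 0 => f1.
(* The second vector is [f] turned by a right angle. *)
exists (\col_i [:: - b; a]`_i); split=> [s t|y].
  rewrite sum_ord2 !mxE /= -/a -/b.
  transitivity ((s ^+ 2 + t ^+ 2) * (a * a + b * b)); first by ring.
  by rewrite f1 mulr1.
exists (a * y 0 0 + b * y 1 0), (a * y 1 0 - b * y 0 0).
apply/colP => i; rewrite !mxE /=.
have [->|->] : i = 0 \/ i = 1.
  by case: i => -[|[|//]] ?; [left|right]; exact: val_inj.
  rewrite /= -/a; transitivity (y 0 0 * (a * a + b * b)); first by rewrite f1 mulr1.
  ring.
rewrite /= -/b; transitivity (y 1 0 * (a * a + b * b)); first by rewrite f1 mulr1.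
ring.
Qed.

(** * The two planes *)

Section Frame.
Variables (R : realType) (S : set 'M[R]_3).
Hypothesis mulS : forall A B, S A -> S B -> S (A *m B).
Hypothesis rankS : forall A, S A -> (2 <= \rank A)%N.

Let K A := S A /\ \rank A = 2%N.

(** Together with [rank2_mulr]: the elements of minimal rank form a two-sided ideal. *)
Lemma rank2_mull A B : S A -> K B -> K (A *m B).
Proof.
move=> SA [SB rB]; have SAB := mulS SA SB; split=> //.
by apply/eqP; rewrite eqn_leq rankS // andbT (leq_trans (mxrankM_maxr _ _)) ?rB.
Qed.

Lemma rank2_mulr A B : K A -> S B -> K (A *m B).
Proof.
move=> [SA rA] SB; have SAB := mulS SA SB; split=> //.
by apply/eqP; rewrite eqn_leq rankS // andbT (leq_trans (mxrankM_maxl _ _)) ?rA.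
Qed.

Lemma rank2_neq0 A : K A -> A != 0.
Proof. by move=> [_ rA]; rewrite -mxrank_eq0 rA. Qed.

Lemma rank2_singular A : K A -> A \notin unitmx.
Proof. by move=> [_ rA]; rewrite -row_free_unit /row_free rA. Qed.

(** [A *m B] has the rank, hence the image, of [A]. Geometrically, [B *m y] is the projection of [x]
    along the kernel of [A] onto the image of [B]. *)
Lemma rank2_onto A B (x : 'cV_3) : K A -> K B -> exists y, A *m x = A *m (B *m y).
Proof.
move=> KA KB; have [Z AE] : exists Z, A = A *m B *m Z.
  apply: mulmx_rank_factorr.
  have [_ rAB] := rank2_mulr KA KB.1; have [_ rA] := KA.
  by rewrite rAB rA.
by exists (Z *m x); rewrite {1}AE !mulmxA.
Qed.

Section Seminorm.
Variables (A0 : 'M[R]_3) (psi : 'M[R]_(2, 3)) (W : 'M[R]_(3, 2)).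
Hypotheses (KA0 : K A0) (A0E : A0 = W *m psi).
Hypothesis psi_inv : forall B C (x : 'cV_3), S B -> \rank B = 2%N -> S C ->
  dotcv (psi *m (C *m (B *m x))) (psi *m (C *m (B *m x))) =
  dotcv (psi *m (B *m x)) (psi *m (B *m x)).

(** [A0 *m B] has rank at least 2 and factors through [psi *m B], which therefore has full row
    rank. *)
Lemma seminorm_onto B (y : 'cV_2) : K B -> exists x, psi *m (B *m x) = y.
Proof.
move=> KB; have : row_free (psi *m B).
  rewrite /row_free eqn_leq rank_leq_row /=.
  have [SA0B _] := rank2_mull KA0.1 KB; apply: leq_trans (rankS SA0B) _.
  by rewrite A0E -mulmxA mxrankM_maxr.
by move=> /row_freeP[D D1]; exists (D *m y); rewrite !mulmxA D1 mul1mx.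
Qed.

(** [A0 *m B] has the rank of [B] and factors through [psi *m B], so [B *m x] is determined by its
    image under [psi]. *)
Lemma seminorm_inj B (x y : 'cV_3) : K B ->
  psi *m (B *m x) = psi *m (B *m y) -> B *m x = B *m y.
Proof.
move=> KB; have [Z BE] : exists Z, B = Z *m (A0 *m B).
  apply: mulmx_rank_factorl.
  have [_ rAB] := rank2_mull KA0.1 KB; have [_ rB] := KB.
  by rewrite rAB rB.
have E (z : 'cV_3) : B *m z = Z *m W *m (psi *m (B *m z)) by rewrite {1}BE A0E !mulmxA.
by move=> pxy; rewrite (E x) pxy -E.
Qed.

Variables (f g : 'cV[R]_2).
Hypothesis fg_norm : forall s t,
  dotcv (s *: f + t *: g) (s *: f + t *: g) = s ^+ 2 + t ^+ 2.
Hypothesis fg_span : forall y, exists s t, y = s *: f + t *: g.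

Lemma seminorm_coord B (z x y : 'cV_3) : K B ->
  psi *m (B *m x) = f -> psi *m (B *m y) = g ->
  exists s t, B *m z = s *: (B *m x) + t *: (B *m y).
Proof.
move=> KB px py; have [s [t zE]] := fg_span (psi *m (B *m z)).
exists s, t; rewrite !scalemxAr -mulmxDr; apply: seminorm_inj => //.
by rewrite zE !mulmxDr -!scalemxAr px py.
Qed.

(* In the plane of B1 take u, v and in that of B2 take u, w, where u spans
   their intersection and v - w spans the kernel of A0. The projection along
   the kernel of A1 from the first plane to the second is an isometry fixing
   u; it is not the one sending v to w, hence it sends v to - w. *)
Lemma second_kernel B1 B2 A1 (x1 x2 y1 y2 k : 'cV_3) : K B1 -> K B2 -> K A1 ->
  B1 *m x1 = B2 *m x2 -> psi *m (B1 *m x1) = f ->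
  psi *m (B1 *m y1) = g -> psi *m (B2 *m y2) = g ->
  B1 *m y1 <> B2 *m y2 -> A0 *m k = 0 -> A1 *m k <> 0 ->
  A1 *m (B1 *m y1 + B2 *m y2) = 0.
Proof.
move=> KB1 KB2 KA1 uE pu pv pw vw A0k A1k.
set v := B1 *m y1 in pv vw *; set w := B2 *m y2 in pw vw *.
have [z vz] := rank2_onto v KA1 KB2.
have [a [b yE]] : exists a b, B2 *m z = a *: (B2 *m x2) + b *: w.
  by apply: seminorm_coord => //; rewrite -uE.
(* In the bases u, v and u, w, the projection along the kernel of [A1] sends (s, t) to (s + t a, t
   b). [A1] takes equal values on a vector and its projection, and preserves the seminorm of
   each. *)
have iso s t : s ^+ 2 + t ^+ 2 = (s + t * a) ^+ 2 + (t * b) ^+ 2.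
  rewrite -!fg_norm.
  have <- : psi *m (B1 *m (s *: x1 + t *: y1)) = s *: f + t *: g.
    by rewrite !mulmxDr -!scalemxAr pu pv.
  rewrite -(psi_inv _ KB1.1 KB1.2 KA1.1).
  have <- : psi *m (B2 *m (s *: x2 + t *: z)) = (s + t * a) *: f + (t * b) *: g.
    rewrite !mulmxDr -!scalemxAr yE mulmxDr -!scalemxAr -uE pu pw scalerDr !scalerA.
    by rewrite addrA -scalerDl.
  rewrite -(psi_inv _ KB2.1 KB2.2 KA1.1).
  suff -> : A1 *m (B1 *m (s *: x1 + t *: y1)) = A1 *m (B2 *m (s *: x2 + t *: z)) by [].
  by rewrite !mulmxDr -!scalemxAr -uE -/v vz.
have a0 : a = 0 by have := iso 0 1; have := iso 1 1; lra.
have : (b - 1) * (b + 1) = 0 by have := iso 0 1; rewrite a0; lra.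
move=> /eqP; rewrite mulf_eq0 => /orP[]; rewrite ?subr_eq0 ?addr_eq0 => /eqP bE;
  move: vz; rewrite yE a0 bE scale0r add0r.
- rewrite scale1r => A1vw; exfalso.
  (* If b = 1, then [A1] kills [v - w], which spans the kernel of [A0] and so has [k] as a
     multiple. *)
  have [|||c kE] := @kernel_line _ _ A0 (v - w) k KA0.2; rewrite ?subr_eq0 //.
  + exact/eqP.
  + by rewrite A0E -mulmxA mulmxBr pv pw subrr mulmx0.
  by apply: A1k; rewrite kE -scalemxAr mulmxBr A1vw subrr scaler0.
by rewrite scaleN1r mulmxN mulmxDr => ->; rewrite addNr.
Qed.

(** Projecting the plane of [B1] along v + w onto that of [B] preserves the seminorm and adds b (v +
    w), which shifts the [g]-coordinate by 2 b. For u this forces b = 0; for v it leaves b = 0 or b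
    = -1. *)
Lemma only_two_planes B1 B2 A1 B (x1 x2 y1 y2 : 'cV_3) :
  K B1 -> K B2 -> K A1 -> K B ->
  B1 *m x1 = B2 *m x2 -> psi *m (B1 *m x1) = f ->
  psi *m (B1 *m y1) = g -> psi *m (B2 *m y2) = g ->
  A1 *m (B1 *m y1 + B2 *m y2) = 0 ->
  exists2 z, B *m z = B1 *m x1 &
  exists y, B *m y = B1 *m y1 \/ B *m y = B2 *m y2.
Proof.
move=> KB1 KB2 KA1 KB uE pu pv pw A1vw.
set u := B1 *m x1 in pu *; set v := B1 *m y1 in pv A1vw *.
set w := B2 *m y2 in pw A1vw *.
have pvw : psi *m (v + w) = (2 : R) *: g by rewrite mulmxDr pv pw scaler_nat mulr2n.
have vw0 : v + w != 0.
  apply/eqP => vw0; have := fg_norm 0 2; rewrite scale0r add0r -pvw vw0 mulmx0.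
  rewrite /dotcv big1 => [|i _]; last by rewrite mxE mul0r.
  by rewrite expr0n /= add0r => /eqP; rewrite eq_sym sqrf_eq0 pnatr_eq0.
have proj y s t : psi *m (B1 *m y) = s *: f + t *: g ->
    exists z b, B *m z = B1 *m y + b *: (v + w) /\
      s ^+ 2 + t ^+ 2 = s ^+ 2 + (t + 2 * b) ^+ 2.
  move=> pyE; have [z zE] := rank2_onto (B1 *m y) KA1 KB.
  have [|b bE] := @kernel_line _ _ A1 (v + w) (B *m z - B1 *m y) KA1.2 vw0 A1vw.
    by rewrite mulmxBr zE subrr.
  have BzE : B *m z = B1 *m y + b *: (v + w) by rewrite -bE addrC subrK.
  exists z, b; split=> //.
  rewrite -!fg_norm -pyE -(psi_inv _ KB1.1 KB1.2 KA1.1) zE.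
  rewrite (psi_inv _ KB.1 KB.2 KA1.1) BzE mulmxDr -scalemxAr pvw pyE.
  by rewrite scalerA -addrA -scalerDl (mulrC b).
have [|z [b [zE bE]]] := proj x1 1 0; first by rewrite pu scale1r scale0r addr0.
have b0 : b = 0.
  by apply/eqP; rewrite -sqrf_eq0; apply/eqP; lra.
exists z; first by rewrite zE b0 scale0r addr0.
have [|y [c [yE cE]]] := proj y1 0 1; first by rewrite -/v pv scale1r scale0r add0r.
have : c * (c + 1) = 0 by lra.
move=> /eqP; rewrite mulf_eq0 addr_eq0 => /orP[] /eqP c0.
  by exists y; left; rewrite yE c0 scale0r addr0.
(* Here v goes to v - (v + w) = - w, whence the sign. *)
exists (- y); right; rewrite mulmxN yE c0 scaleN1r -/v opprD opprK addrA.
by rewrite addNr add0r.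
Qed.

End Seminorm.
End Frame.

(** * The frame adapted to the two planes *)

Definition axis_vec (R : realType) (s t : R) (j : 'I_3) : 'cV[R]_3 :=
  s *: delta_mx 0 0 + t *: delta_mx j 0.

Section ExistsFrame.
Variables (R : realType) (S : set 'M[R]_3).
Hypothesis mulS : forall A B, S A -> S B -> S (A *m B).
Hypothesis rankS : forall A, S A -> (2 <= \rank A)%N.
Hypothesis irrS : irreducible_family S.
Variables (A0 : 'M[R]_3) (psi : 'M[R]_(2, 3)) (W : 'M[R]_(3, 2)).
Hypotheses (SA0 : S A0) (rA0 : \rank A0 = 2%N) (A0E : A0 = W *m psi).
Hypothesis psi_inv : forall B C (x : 'cV_3), S B -> \rank B = 2%N -> S C ->
  dotcv (psi *m (C *m (B *m x))) (psi *m (C *m (B *m x))) =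
  dotcv (psi *m (B *m x)) (psi *m (B *m x)).

(** The columns of [T] are u, v, w, and the index 1 or 2 selects the plane of u and v or that of u
    and w. The two clauses say that [C] maps one plane into, and onto, another, preserving the
    norm. *)
Lemma exists_frame : exists2 T : 'M[R]_3, T \in unitmx &
  forall C (j : 'I_3), S C -> j != 0 -> exists2 k : 'I_3, k != 0 &
    (forall s t, exists s' t', C *m (T *m axis_vec s t j) = T *m axis_vec s' t' k
       /\ s' ^+ 2 + t' ^+ 2 = s ^+ 2 + t ^+ 2) /\
    (forall s' t', exists s t, C *m (T *m axis_vec s t j) = T *m axis_vec s' t' k
       /\ s' ^+ 2 + t' ^+ 2 = s ^+ 2 + t ^+ 2).
Proof.
have KA0 : S A0 /\ \rank A0 = 2%N by [].
have A00 := rank2_neq0 KA0; have sA0 := rank2_singular KA0.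
(* [C2] moves the image of [A0], so [C2 *m A0] provides a second plane; [C1] moves its kernel, so
   [A0 *m C1] provides a second kernel. *)
have [C2 SC2 [q C2q]] := image_not_invariant irrS A00 sA0.
have [C1 SC1 [k A0k A1k]] := kernel_not_invariant irrS A00 sA0.
have KB2 := rank2_mull mulS rankS SC2 KA0; set B2 := C2 *m A0 in KB2.
have KA1 := rank2_mulr mulS rankS KA0 SC1; set A1 := A0 *m C1 in KA1.
have inj := seminorm_inj mulS rankS KA0 A0E.
have onto := seminorm_onto mulS rankS KA0 A0E.
have [a [b [ab a0]]] : exists a b : 'cV_3, A0 *m a = B2 *m b /\ A0 *m a != 0.
  by apply: images_intersect; rewrite KB2.2 rA0.
pose r := dotcv (psi *m (A0 *m a)) (psi *m (A0 *m a)).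
have r0 : 0 < r.
  rewrite lt0r; apply/andP; split; last first.
    by apply: sumr_ge0 => i _; rewrite -expr2 sqr_ge0.
  apply: contra a0 => /eqP /dotcv_eq0 pa; apply/eqP.
  by rewrite (inj A0 a 0 KA0) ?mulmx0 // pa !mulmx0.
have [x1 [x2 [uE f1]]] : exists x1 x2 : 'cV_3, A0 *m x1 = B2 *m x2 /\
    dotcv (psi *m (A0 *m x1)) (psi *m (A0 *m x1)) = 1.
  exists ((Num.sqrt r)^-1 *: a), ((Num.sqrt r)^-1 *: b).
  rewrite -!scalemxAr ab; split=> //.
  have dotZ z (y : 'cV[R]_2) : dotcv (z *: y) (z *: y) = z ^+ 2 * dotcv y y.
    rewrite /dotcv mulr_sumr; apply: eq_bigr => i _.
    by rewrite !mxE mulrACA.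
  by rewrite -ab dotZ -/r exprVn sqr_sqrtr ?ltW // mulVf // gt_eqF.
have [f pu] : exists f, psi *m (A0 *m x1) = f by exists (psi *m (A0 *m x1)).
rewrite pu in f1.
have [g [fg_norm fg_span]] := orthonormal_frame2 f1.
have [y1 pv] := onto A0 g KA0; have [y2 pw] := onto B2 g KB2.
have coord := seminorm_coord mulS rankS KA0 A0E fg_span.
have vw : A0 *m y1 <> B2 *m y2.
  (* Otherwise the plane of [B2], spanned by u and w = v, would lie in the image of [A0], contrary
     to the choice of [q]. *)
  move=> vw; have [|s [t E]] := coord B2 q x2 y2 KB2 _ pw; first by rewrite -uE.
  apply: (C2q (s *: x1 + t *: y1)).
  by rewrite mulmxA -/B2 E mulmxDr -!scalemxAr uE vw.
have A1vw : A1 *m (A0 *m y1 + B2 *m y2) = 0.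
  apply: (second_kernel mulS rankS KA0 A0E psi_inv fg_norm fg_span
    KA0 KB2 KA1 uE pu pv pw vw A0k).
  by rewrite -mulmxA.
have planes (B : 'M[R]_3) (KB : S B /\ \rank B = 2%N) := only_two_planes mulS rankS psi_inv
  fg_norm KA0 KB2 KA1 KB uE pu pv pw A1vw.
set v := A0 *m y1 in pv vw A1vw planes; set w := B2 *m y2 in pw vw A1vw planes.
set u := A0 *m x1 in uE pu planes.
pose T : 'M[R]_3 := \matrix_(i, j) nth 0 [:: u i 0; v i 0; w i 0] j.
have Te0 : col 0 T = u by apply/colP => i; rewrite !mxE.
have Te1 : col 1 T = v by apply/colP => i; rewrite !mxE.
have Te2 : col 2 T = w by apply/colP => i; rewrite !mxE.
have TE s t j : T *m axis_vec s t j = s *: u + t *: (col j T).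
  by rewrite /axis_vec mulmxDr -!scalemxAr -!colE Te0.
have pT j : j != 0 -> psi *m (col j T) = g.
  by have [->|->|->] := ord3P j; rewrite ?eqxx // ?Te1 ?Te2.
have normT s t j : j != 0 ->
    dotcv (psi *m (T *m axis_vec s t j)) (psi *m (T *m axis_vec s t j))
    = s ^+ 2 + t ^+ 2.
  by move=> j0; rewrite TE mulmxDr -!scalemxAr pu pT // fg_norm.
have plane j : j != 0 -> exists B (x y : 'cV_3),
    [/\ S B /\ \rank B = 2%N, B *m x = u & B *m y = col j T].
  have [->|->|->] := ord3P j; first by rewrite eqxx.
    by exists A0, x1, y1; split=> //; rewrite Te1.
  by exists B2, x2, y2; split=> //; rewrite Te2.
have planes' B : S B /\ \rank B = 2%N -> exists (x : 'cV_3), B *m x = u /\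
    exists2 k : 'I_3, k != 0 & exists y, B *m y = col k T.
  move=> KB; have [x xE [y yE]] := planes B KB; exists x; split=> //.
  by case: yE => yE; [exists 1|exists 2] => //; exists y; rewrite ?Te1 ?Te2.
exists T.
  (* Applying [psi] to a relation between u, v, w leaves only multiples of v - w, which is
     nonzero. *)
  apply: contrapT => /negP/singular_kernel[z z0 Tz].
  have zE : T *m z = z 0 0 *: u + z 1 0 *: v + z 2 0 *: w.
    apply/colP => i; rewrite !mxE sum_ord3 !mxE /=.
    by rewrite ![_ * z _ _]mulrC.
  have pz : psi *m (T *m z) = z 0 0 *: f + (z 1 0 + z 2 0) *: g.
    by rewrite zE !mulmxDr -!scalemxAr pu pv pw scalerDl addrA.
  have /eqP := fg_norm (z 0 0) (z 1 0 + z 2 0); rewrite -pz Tz mulmx0.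
  rewrite [dotcv 0 0]big1 => [|i _]; last by rewrite mxE mul0r.
  rewrite eq_sym paddr_eq0 ?sqr_ge0 // !sqrf_eq0 addrC addr_eq0.
  move=> /andP[/eqP z00 /eqP z2].
  have /eqP : z 1 0 *: (v - w) = 0.
    by rewrite -[RHS]Tz zE z00 z2 scale0r add0r scalerBr scaleNr.
  rewrite scaler_eq0 subr_eq0 => /orP[/eqP z10|/eqP //].
  move/eqP: z0; apply; apply/colP => i; rewrite !mxE.
  by have [->|->|->] := ord3P i; rewrite ?z00 ?z2 ?z10 ?oppr0.
move=> C j SC /[dup] j0 /plane[B [x [y [KB xE yE]]]].
(* The plane with index [j] is the image of [B], and [C *m B] again has rank 2, so its image is one
   of the two planes. *)
have KCB := rank2_mull mulS rankS SC KB.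
have [x' [x'E [l l0 [y' y'E]]]] := planes' _ KCB.
exists l => //.
have BE s t : T *m axis_vec s t j = B *m (s *: x + t *: y).
  by rewrite TE mulmxDr -!scalemxAr xE yE.
have CBE s t : T *m axis_vec s t l = C *m (B *m (s *: x' + t *: y')).
  by rewrite mulmxA TE mulmxDr -!scalemxAr x'E y'E.
have norm s t s' t' : C *m (T *m axis_vec s t j) = T *m axis_vec s' t' l ->
    s' ^+ 2 + t' ^+ 2 = s ^+ 2 + t ^+ 2.
  move=> E; rewrite -(normT _ _ _ l0) -(normT _ _ _ j0) -E BE.
  by rewrite (psi_inv _ KB.1 KB.2 SC).
split=> [s t|s' t'].
  have [||s' [t' E]] := coord _ (s *: x + t *: y) x' y' KCB.
  - by rewrite x'E.
  - by rewrite y'E pT.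
  exists s', t'; have E' : C *m (T *m axis_vec s t j) = T *m axis_vec s' t' l.
    by rewrite BE TE mulmxA E x'E y'E.
  by split=> //; exact: norm.
have [||s [t E]] := coord _ (s' *: x' + t' *: y') x y KB.
- by rewrite xE.
- by rewrite yE pT.
exists s, t; have E' : C *m (T *m axis_vec s t j) = T *m axis_vec s' t' l.
  by rewrite CBE E TE xE yE.
by split=> //; exact: norm.
Qed.

End ExistsFrame.

(** * Discs *)

Section AxisPlanes.
Variable R : realType.
Implicit Types (j : 'I_3) (x : 'cV[R]_3).

Definition axis_plane j : {vspace 'cV[R]_3} :=
  << [tuple delta_mx 0 0; delta_mx j 0]%R >>%VS.

Lemma axis_planeP j x : reflect (exists s t, x = axis_vec s t j) (x \in axis_plane j).
Proof.
apply: (iffP (@span_tupleP _ _ _ _ _)) => [[c ->]|[s [t ->]]].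
  by exists (c 0), (c 1); rewrite sum_ord2.
by exists (fun i => if i == 0 then s else t); rewrite sum_ord2.
Qed.

Lemma dim_axis_plane j : j != 0 -> \dim (axis_plane j) = 2%N.
Proof.
move=> j0; apply/eqP; rewrite /axis_plane.
have : free [:: delta_mx 0 0 : 'cV[R]_3; delta_mx j 0].
  rewrite free_cons seq1_free span_seq1; apply/andP; split.
    apply/vlineP => -[c /matrixP/(_ 0 0)]; rewrite !mxE eqxx [0 == j]eq_sym.
    by rewrite (negbTE j0) mulr0 => /eqP; rewrite oner_eq0.
  apply/eqP => /matrixP/(_ j 0); rewrite !mxE !eqxx => /eqP.
  by rewrite oner_eq0.
by [].
Qed.

Lemma axis_vec_dot (m : 'cV[R]_3) s t j :
  dotcv m (axis_vec s t j) = s * m 0 0 + t * m j 0.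
Proof.
rewrite /dotcv /axis_vec sum_ord3 !mxE !eqxx /=.
by have [->|->|->] := ord3P j; rewrite /=; ring.
Qed.

Lemma axis_vec_norm (s t : R) j : j != 0 ->
  dotcv (axis_vec s t j) (axis_vec s t j) = s ^+ 2 + t ^+ 2.
Proof.
rewrite axis_vec_dot /axis_vec !mxE /=.
by have [->|->|->] := ord3P j; rewrite ?eqxx //= => _; ring.
Qed.

(** The normals of the two planes are the multiples of the third and of the second basis vector. *)
Lemma orthogonal_axis_planes : orthogonal_planes (axis_plane 1) (axis_plane 2).
Proof.
split; [exact: dim_axis_plane|exact: dim_axis_plane|move=> m n mP nP].
have coord (p : 'cV[R]_3) j : normal_to (axis_plane j) p -> p 0 0 = 0 /\ p j 0 = 0.
  move=> pP; split.
    have := pP (axis_vec 1 0 j); rewrite axis_vec_dot mul1r mul0r addr0; apply.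
    by apply/axis_planeP; exists 1, 0.
  have := pP (axis_vec 0 1 j); rewrite axis_vec_dot mul1r mul0r add0r; apply.
  by apply/axis_planeP; exists 0, 1.
have [m0 m1] := coord _ _ mP; have [n0 n2] := coord _ _ nP.
by rewrite /dotcv sum_ord3 m0 m1 n2 !mul0r mulr0 !addr0.
Qed.

Lemma disc_image (B : 'M[R]_3) j k : j != 0 -> k != 0 ->
  (forall s t, exists s' t', B *m axis_vec s t j = axis_vec s' t' k
     /\ s' ^+ 2 + t' ^+ 2 = s ^+ 2 + t ^+ 2) ->
  (forall s' t', exists s t, B *m axis_vec s t j = axis_vec s' t' k
     /\ s' ^+ 2 + t' ^+ 2 = s ^+ 2 + t ^+ 2) ->
  mulmx B @` disc (axis_plane j) 1 = disc (axis_plane k) 1.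
Proof.
move=> j0 k0 BI BO; apply/seteqP; split.
  move=> _ [x [/axis_planeP[s [t ->]] le1] <-].
  have [s' [t' [-> st]]] := BI s t; split; first by apply/axis_planeP; exists s', t'.
  by move: le1; rewrite /euclidean_norm !axis_vec_norm // st.
move=> y [/axis_planeP[s' [t' ->]] le1].
have [s [t [BE st]]] := BO s' t'; exists (axis_vec s t j) => //.
split; first by apply/axis_planeP; exists s, t.
by move: le1; rewrite /euclidean_norm !axis_vec_norm // st.
Qed.

End AxisPlanes.

Theorem proposition10 (R : realType) (S : set 'M[R]_3)
    (hS : matrix_semigroup S)
    (hirr : irreducible_family S)
    (hcsr : constant_spectral_radius S)
    (hrank : minimal_rank S 2) :
  exists2 T : 'M[R]_3, T \in unitmx &
  exists (P1 P2 : {vspace 'cV[R]_3}) (rho : R),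
    [/\ orthogonal_planes P1 P2, 0 < rho &
      forall A, S A ->
        let B := invmx T *m A *m T in
        (mulmx B @` disc P1 rho = disc P1 rho \/
         mulmx B @` disc P1 rho = disc P2 rho) /\
        (mulmx B @` disc P2 rho = disc P2 rho \/
         mulmx B @` disc P2 rho = disc P1 rho)].
Proof.
have [mulS clS] := hS; have [rho _ srS] := hcsr; have [[A0 SA0 rA0] rankS] := hrank.
have trS A : S A -> `|\tr A| <= 3%:R * rho.
  by move=> /srS <-; exact: trace_le_spectral_radius.
have [c bS] := irreducible_semigroup_bounded mulS hirr trS.
have [psi [W [A0E psi_inv]]] := invariant_seminorm clS bS mulS rankS SA0 rA0.
have [T Tu TS] := exists_frame mulS rankS hirr SA0 rA0 A0E psi_inv.
exists T => //; exists (axis_plane R 1), (axis_plane R 2), 1.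
split=> [||A SA B]; [exact: orthogonal_axis_planes|exact: ltr01|].
have BE x y : A *m (T *m x) = T *m y -> B *m x = y.
  by rewrite /B -!mulmxA => ->; rewrite mulKmx.
have image j : j != 0 -> exists2 k : 'I_3, k != 0 &
    mulmx B @` disc (axis_plane R j) 1 = disc (axis_plane R k) 1.
  move=> j0; have [k k0 [TI TO]] := TS A j SA j0; exists k => //.
  apply: disc_image => // [s t|s' t'].
    by have [s' [t' [E st]]] := TI s t; exists s', t'; split=> //; exact: BE.
  by have [s [t [E st]]] := TO s' t'; exists s, t; split=> //; exact: BE.
have [k1 k10 ->] := image 1 isT; have [k2 k20 ->] := image 2 isT.
(* A nonzero index is 1 or 2, so each disc goes to one of the two discs. *)
split; [move: k10; have [->|->|->] := ord3P k1|move: k20; have [->|->|->] := ord3P k2];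
  by rewrite ?eqxx // => _; (try by left); right.
Qed.
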